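(* Let $M(t)$ be the solution of the ODE $$\partial_tM+M^2-\frac13|M|^2I_3=0$$ on the space of real symmetric trace-free $3\times3$ matrices, let $\lambda_1(t)\leq\lambda_2(t)\leq\lambda_3(t)$ be the eigenvalues of $M(t)$, and let $r(t)=-\frac{\lambda_1(t)}{\lambda_3(t)}$. Suppose $\lambda_3(0)>0$ and $r(0)>\frac12$. Then there exists $T>0$ such that $\lim_{t\to T}\lambda_3(t)=+\infty$, and furthermore $\lim_{t\to T}r(t)=2$.
   Context: $|M|^2=\sum_{i,j=1}^3M_{ij}^2$ and $I_3$ is the $3\times3$ identity matrix. Equivalently, the eigenvalues satisfy $\lambda_1+\lambda_2+\lambda_3=0$ and $\partial_t\lambda_i=-\lambda_i^2+\frac13(\lambda_1^2+\lambda_2^2+\lambda_3^2)$ for $i=1,2,3$. The limits $t\to T$ are from the left, $T$ being the end of the interval of existence of the solution. *)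

(* Defs.v *)
From HB Require Import structures.
From mathcomp Require Export all_boot all_order all_algebra.
From mathcomp Require Export all_classical all_reals all_analysis.

Set Implicit Arguments.
Unset Strict Implicit.
Unset Printing Implicit Defensive.

Import Order.TTheory GRing.Theory Num.Theory.
Import numFieldNormedType.Exports.

Local Open Scope classical_set_scope.
Local Open Scope ring_scope.

(* The normed-module norm of 'M[R]_3 is the maximum norm, so the Frobenius
   norm has to be written out. *)
Definition frobenius_sq (R : realType) (A : 'M[R]_3) : R :=
  \sum_(i < 3) \sum_(j < 3) A i j ^+ 2.

Definition sym_tracefree (R : realType) (A : 'M[R]_3) : Prop :=
  A^T = A /\ \tr A = 0.

Definition ode_rhs (R : realType) (A : 'M[R]_3) : 'M[R]_3 :=
  (3^-1 * frobenius_sq A)%:M - A *m A.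

(* Solutions on [0, T[, with T possibly infinite; the derivative at 0 is
   one-sided, and the values of M outside [0, T[ are irrelevant. *)
Definition ode_solution (R : realType) (M : R -> 'M[R]_3) (T : \bar R) : Prop :=
  [/\ (0 < T)%E,
      forall t : R, 0 <= t -> (t%:E < T)%E -> sym_tracefree (M t),
      h^-1 *: (M h - M 0) @[h --> 0^'+] --> ode_rhs (M 0)
    & forall t : R, 0 < t -> (t%:E < T)%E ->
        is_derive t (1 : R) M (ode_rhs (M t))].

(* [0, T[ is the whole forward interval of existence: no solution on a longer
   interval extends M. *)
Definition maximal_ode_solution (R : realType) (M : R -> 'M[R]_3)
    (T : \bar R) : Prop :=
  ode_solution M T /\
  forall (N : R -> 'M[R]_3) (S : \bar R), ode_solution N S ->
    (forall t : R, 0 <= t -> (t%:E < T)%E -> N t = M t) -> (S <= T)%E.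

Definition ordered_eigenvalues (R : realType) (A : 'M[R]_3) (a b c : R) : Prop :=
  [/\ a <= b, b <= c
    & char_poly A = ('X - a%:P) * ('X - b%:P) * ('X - c%:P)].

(* Main.v *)
Require Import Defs.
From mathcomp Require Import all_boot all_order all_algebra.
From mathcomp Require Import all_classical all_reals all_analysis.
From mathcomp Require Import ring lra.
Import Order.TTheory GRing.Theory Num.Theory.
Import numFieldNormedType.Exports.
Local Open Scope classical_set_scope.
Local Open Scope ring_scope.

(** Everything is governed by two scalar invariants of the matrix [M], the
    squared norm [s = |M|^2] and the determinant [d = det M].  Along a solution
    they satisfy the closed system
      [s' = - 6 d],  [d' = - s^2 / 6],
    so [s^3 - 54 d^2], which is twice the discriminant of the characteristic
    polynomial, is a constant [C >= 0] ([discriminant_conserved]).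

    The condition [r(0) > 1/2] says that the lowest eigenvalue is simple at time
    [0]: either [C > 0], or the two upper eigenvalues coincide and [d(0) < 0].
    In both cases [s] stays away from [0] ([norm_bounded_below]), so [d]
    decreases at a definite rate and becomes negative.  From then on [s / d] is
    negative while [(s / d)' = - 6 + s^3 / (6 d^2) >= 3], which cannot last:
    the lifetime [T] is finite ([blowup_time_finite]).

    If [d] were bounded below on [[0, T[], conservation of [C] would bound [s],
    hence all entries of [M], and the solution would continue past [T]
    ([bounded_solution_extends]).  Hence [d] tends to [-oo] at [T]
    ([maximal_det_unbounded]).  Once [d < 0] the two upper eigenvalues are
    positive and [- d <= 2 lambda3^3], so [lambda3] tends to [+oo]; the
    conserved discriminant contains the factors [(lambda2 - lambda1)^2] and
    [(lambda3 - lambda1)^2], both at least [lambda3^2], so [lambda3 - lambda2]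
    stays bounded and [2 - r = (lambda3 - lambda2) / lambda3] tends to [0].

    Continuation needs a solution of the equation through an arbitrary matrix
    [A] ([local_existence]), which can be written down explicitly.  By the
    Cayley-Hamilton theorem, squaring preserves, up to scalar matrices, the
    plane spanned by [A] and [X = ode_rhs A], so one looks for a solution of
    the form [a (A + v X)].  This reduces to [v' = a^-2] with [a^-3] the cubic
    [1 - (s/2) v^2 + d v^3], where [s] and [d] are the invariants of [A]; it is
    a separable scalar equation, solved by inverting a primitive
    ([autonomous_ode_local_solution]). *)

(** * Three by three matrices and their eigenvalues *)

Definition i0 : 'I_3 := @Ordinal 3 0 isT.
Definition i1 : 'I_3 := @Ordinal 3 1 isT.
Definition i2 : 'I_3 := @Ordinal 3 2 isT.

Lemma sum3 (V : zmodType) (F : 'I_3 -> V) :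
  \sum_(i < 3) F i = F i0 + F i1 + F i2.
Proof.
rewrite !big_ord_recr big_ord0 /= add0r.
by congr (F _ + F _ + F _); apply: val_inj.
Qed.

Lemma ord3P (P : 'I_3 -> Prop) : P i0 -> P i1 -> P i2 -> forall i, P i.
Proof.
move=> p0 p1 p2 [[|[|[|//]]] hi].
- by have -> : Ordinal hi = i0 by apply: val_inj.
- by have -> : Ordinal hi = i1 by apply: val_inj.
- by have -> : Ordinal hi = i2 by apply: val_inj.
Qed.

Lemma det3 (K : comNzRingType) (A : 'M[K]_3) :
  \det A = A i0 i0 * (A i1 i1 * A i2 i2 - A i1 i2 * A i2 i1)
         - A i0 i1 * (A i1 i0 * A i2 i2 - A i1 i2 * A i2 i0)
         + A i0 i2 * (A i1 i0 * A i2 i1 - A i1 i1 * A i2 i0).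
Proof.
have det2 (B : 'M[K]_2) : \det B = B 0 0 * B 1 1 - B 0 1 * B 1 0.
  rewrite (expand_det_row _ 0) 2!big_ord_recr big_ord0 /= add0r /cofactor
    !det_mx11 !mxE /=.
  have -> : widen_ord (leqnSn 1) ord_max = 0 :> 'I_2 by apply: val_inj.
  have -> : ord_max = 1 :> 'I_2 by apply: val_inj.
  have -> : lift 0 0 = 1 :> 'I_2 by apply: val_inj.
  have -> : lift 1 0 = 0 :> 'I_2 by apply: val_inj.
  rewrite /=; ring.
have l00 : lift i0 (0 : 'I_2) = i1 by apply: val_inj.
have l01 : lift i0 (1 : 'I_2) = i2 by apply: val_inj.
have l10 : lift i1 (0 : 'I_2) = i0 by apply: val_inj.
have l11 : lift i1 (1 : 'I_2) = i2 by apply: val_inj.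
have l20 : lift i2 (0 : 'I_2) = i0 by apply: val_inj.
have l21 : lift i2 (1 : 'I_2) = i1 by apply: val_inj.
rewrite (expand_det_row _ i0) sum3 /cofactor !det2 !mxE.
rewrite !(l00, l01, l10, l11, l20, l21) /=; ring.
Qed.

Lemma sym_tracefreeE (R : realType) (A : 'M[R]_3) : sym_tracefree A ->
  [/\ A i1 i0 = A i0 i1, A i2 i0 = A i0 i2, A i2 i1 = A i1 i2
    & A i2 i2 = - A i0 i0 - A i1 i1].
Proof.
case=> sA; rewrite /mxtrace sum3 => tA.
have e i j : A i j = A j i by rewrite -[in LHS]sA mxE.
by split; [exact: e | exact: e | exact: e | lra].
Qed.

Lemma ode_rhsE (R : realType) (A : 'M[R]_3) i j :
  ode_rhs A i j = 3^-1 * frobenius_sq A *+ (i == j)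
    - (A i i0 * A i0 j + A i i1 * A i1 j + A i i2 * A i2 j).
Proof. by rewrite !mxE sum3. Qed.

Lemma frobenius_sqE (R : realType) (A : 'M[R]_3) :
  frobenius_sq A = A i0 i0 ^+ 2 + A i0 i1 ^+ 2 + A i0 i2 ^+ 2
    + (A i1 i0 ^+ 2 + A i1 i1 ^+ 2 + A i1 i2 ^+ 2)
    + (A i2 i0 ^+ 2 + A i2 i1 ^+ 2 + A i2 i2 ^+ 2).
Proof. by rewrite /frobenius_sq !sum3. Qed.

(** The characteristic polynomial of a symmetric trace-free matrix is
    [X^3 - (|A|^2 / 2) X - det A]; its values at [0], [1] and [-1] determine the
    elementary symmetric functions of the roots. *)
Lemma eigenvalues_invariants (R : realType) (A : 'M[R]_3) (a b c : R) :
  sym_tracefree A -> ordered_eigenvalues A a b c ->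
  [/\ a + b + c = 0, frobenius_sq A = a ^+ 2 + b ^+ 2 + c ^+ 2
    & \det A = a * b * c].
Proof.
move=> /sym_tracefreeE[e10 e20 e21 e22] [_ _ eA].
have ev x : \det (x%:M - A) = (x - a) * (x - b) * (x - c).
  have <- : (char_poly A).[x] = \det (x%:M - A).
    rewrite -/(horner_eval x _) /char_poly -det_map_mx.
    congr (\det _); apply/matrixP => i j.
    by rewrite !mxE /= /horner_eval hornerD hornerN hornerC hornerMn hornerX.
  by rewrite eA !hornerE.
have := ev 0; have := ev 1; have := ev (-1).
rewrite frobenius_sqE !det3 !mxE /= e10 e20 e21 e22 ?mulr1n ?mulr0n => h1 h2 h3.
have s0 : a + b + c = 0 by lra.
split => //.
- have -> : a ^+ 2 + b ^+ 2 + c ^+ 2 = (a + b + c) ^+ 2 - 2 * (a*b+b*c+a*c).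
    by ring.
  by rewrite s0; lra.
- lra.
Qed.

Lemma sqr_entry_le_frobenius (R : realType) (A : 'M[R]_3) i j :
  A i j ^+ 2 <= frobenius_sq A.
Proof.
rewrite /frobenius_sq (bigD1 i)//= (bigD1 j)//= -addrA lerDl addr_ge0//.
  by apply: sumr_ge0 => k _; exact: sqr_ge0.
by apply: sumr_ge0 => k _; apply: sumr_ge0 => l _; exact: sqr_ge0.
Qed.

Lemma frobenius_sq_ge0 (R : realType) (A : 'M[R]_3) : 0 <= frobenius_sq A.
Proof.
by apply: le_trans (sqr_entry_le_frobenius _ A i0 i0); exact: sqr_ge0.
Qed.

Section eigenvalue_triples.
Variables (R : realType) (a b c : R).

Lemma discriminant_eigenvalues : a + b + c = 0 ->
  (a ^+ 2 + b ^+ 2 + c ^+ 2) ^+ 3 - 54 * (a * b * c) ^+ 2 =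
  2 * ((a - b) * (b - c) * (a - c)) ^+ 2.
Proof. by move=> abc0; have -> : a = - b - c; [lra | ring]. Qed.

(** When [a < b], the discriminant vanishes only if the two upper eigenvalues
    coincide, and then the determinant has the sign of the lowest one. *)
Lemma simple_lowest_eigenvalue : a + b + c = 0 -> b <= c -> a < b ->
  0 < 2 * ((a - b) * (b - c) * (a - c)) ^+ 2 \/ a * b * c < 0.
Proof.
move=> abc0 + ltab; rewrite le_eqVlt => /orP[/eqP e|ltbc].
  right; rewrite -mulrA -e -expr2 pmulr_llt0; first lra.
  by rewrite exprn_even_gt0//=; apply/eqP => b0; lra.
left; rewrite mulr_gt0// exprn_even_gt0//= !mulf_neq0// subr_eq0 lt_eqF//.
exact: lt_trans ltbc.
Qed.

Lemma negative_det_signs : a + b + c = 0 -> a <= b -> b <= c ->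
  a * b * c < 0 -> a < 0 /\ 0 < b.
Proof.
move=> abc0 ab bc d0; have c0 : 0 < c.
  have c_ge0 : 0 <= c by lra.
  by rewrite lt_neqAle c_ge0 andbT eq_sym; apply: contraTneq d0 => ->;
    rewrite mulr0 ltxx.
move: d0; rewrite pmulr_llt0// => ab0.
have a0 : a < 0.
  by case: (ltP a 0) => // a_ge0; move: ab0; rewrite ltNge mulr_ge0//; lra.
by split=> //; move: ab0; rewrite nmulr_rlt0.
Qed.

(** The product [- a b c] equals [(b + c) b c], at most [2 c^3]. *)
Lemma top_eigenvalue_ge k : a + b + c = 0 -> a <= b -> b <= c ->
  0 < k -> a * b * c < - (2 * k ^+ 3) -> k <= c.
Proof.
move=> abc0 ab bc k0 dk.
have k3 : 0 < k ^+ 3 by rewrite exprn_gt0.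
have [a0 b0] := negative_det_signs abc0 ab bc ltac:(lra).
case: (leP k c) => // ck; exfalso.
have c0 : 0 < c by lra.
have e1 : - (a * b * c) <= 2 * c ^+ 3.
  have -> : - (a * b * c) = (b + c) * (b * c).
    by have -> : a = - b - c; [lra | ring].
  have -> : 2 * c ^+ 3 = (c + c) * (c * c) by ring.
  by apply: ler_pM; rewrite ?lerD2r ?ler_wpM2r ?mulr_ge0//; lra.
have : c ^+ 3 < k ^+ 3 by rewrite ltrXn2r//; lra.
lra.
Qed.

(** Since [b] and [c] are positive, both [b - a] and [c - a] are at least
    [c >= 1], so the discriminant dominates [(c - b)^2]. *)
Lemma ratio_defect_le : a + b + c = 0 -> a <= b -> b <= c ->
  a * b * c < 0 -> 1 <= c ->
  `|2 + a / c| <= (((a - b) * (b - c) * (a - c)) ^+ 2 + 1) / c.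
Proof.
move=> abc0 ab bc d0 c1; have [a0 b0] := negative_det_signs abc0 ab bc d0.
have c0 : 0 < c by lra.
have -> : 2 + a / c = (c - b) / c.
  by have -> : a = - b - c; [lra | field; lra].
rewrite normrM ger0_norm ?subr_ge0// gtr0_norm ?invr_gt0// ler_pM2r ?invr_gt0//.
have -> : ((a - b) * (b - c) * (a - c)) ^+ 2 =
    (c - b) ^+ 2 * ((b - a) * (c - a)) ^+ 2 by ring.
have h1 : 1 <= ((b - a) * (c - a)) ^+ 2.
  by rewrite expr2 !mulr_ege1//; lra.
have h2 : (c - b) ^+ 2 <= (c - b) ^+ 2 * ((b - a) * (c - a)) ^+ 2.
  by rewrite ler_peMr// sqr_ge0.
have : 0 <= (c - b - 1) ^+ 2 by exact: sqr_ge0.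
rewrite sqrrB1; lra.
Qed.
End eigenvalue_triples.

(** * Derivatives of the two invariants *)

Lemma is_derive_continuous (R : realType) (f : R -> R) (x l : R) :
  is_derive x (1 : R) f l -> {for x, continuous f}.
Proof.
by case=> dx _; exact/differentiable_continuous/derivable1_diffP.
Qed.

Section derivatives.
Variables (R : realType) (M : R -> 'M[R]_3) (t : R).
Hypothesis sM : sym_tracefree (M t).
Hypothesis dM : is_derive t (1 : R) M (ode_rhs (M t)).

Lemma is_derive_entry (V : R -> 'M[R]_3) (D : 'M[R]_3) i j :
  is_derive t (1 : R) V D -> is_derive t (1 : R) (fun x => V x i j) (D i j).
Proof.
case=> dV <-; rewrite derive_mx// mxE; apply: DeriveDef => //.
exact: (derivable_mxP _ _ _).1.
Qed.

Lemma is_derive_matrix (V : R -> 'M[R]_3) (D : 'M[R]_3) :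
  (forall i j, is_derive t (1 : R) (fun x => V x i j) (D i j)) ->
  is_derive t (1 : R) V D.
Proof.
move=> h; have dV : derivable V t 1.
  by apply/derivable_mxP => i j; case: (h i j).
apply: DeriveDef => //; rewrite derive_mx//; apply/matrixP => i j.
by rewrite mxE; case: (h i j).
Qed.

(** For trace-free symmetric [M] one has [(tr M^2)' = - 2 tr M^3], and
    [tr M^3 = 3 det M] when the trace is zero. *)
Lemma is_derive_frobenius :
  is_derive t (1 : R) (fun x => frobenius_sq (M x)) (- (6 * \det (M t))).
Proof.
have h i j := is_derive_entry _ _ i j dM.
under eq_fun do rewrite frobenius_sqE.
apply: is_derive_eq.
rewrite !ode_rhsE /= !frobenius_sqE det3 /GRing.scale /=.
have [-> -> -> ->] := sym_tracefreeE _ _ sM.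
by field.
Qed.

(** As [3 det M = tr M^3], the derivative is [|M|^4 / 3 - tr M^4], and
    [tr M^4 = |M|^4 / 2] by the Cayley-Hamilton theorem. *)
Lemma is_derive_det :
  is_derive t (1 : R) (fun x => \det (M x)) (- (frobenius_sq (M t) ^+ 2 / 6)).
Proof.
have h i j := is_derive_entry _ _ i j dM.
under eq_fun do rewrite det3.
apply: is_derive_eq.
rewrite !ode_rhsE /= !frobenius_sqE /GRing.scale /=.
have [-> -> -> ->] := sym_tracefreeE _ _ sM.
by field.
Qed.
End derivatives.

(** * Mean value estimates from an endpoint *)

(** The data available about a solution: differentiability strictly after the
    initial time [t0], continuity from the right at [t0].  The initial time is a
    parameter because the quotient of the two invariants is only considered
    once the determinant is negative. *)
Definition evolves (R : realType) (t0 : R) (T : \bar R) (f f' : R -> R) :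
    Prop :=
  f t @[t --> t0^'+] --> f t0 /\
  forall t : R, t0 < t -> (t%:E < T)%E -> is_derive t (1 : R) f (f' t).

Section evolution.
Variables (R : realType) (t0 : R) (T : \bar R).
Implicit Types f g : R -> R.

Lemma evolves_MVT f f' (a b : R) : evolves R t0 T f f' ->
  t0 <= a -> a < b -> (b%:E < T)%E ->
  exists2 c : R, a < c < b & f b - f a = f' c * (b - a).
Proof.
move=> [f0 df] a0 ab bT.
have b0 := le_lt_trans a0 ab.
have dfc c : t0 < c -> c <= b -> is_derive c (1 : R) f (f' c).
  by move=> c0 cb; apply: df => //; apply: le_lt_trans bT; rewrite lee_fin.
have cfc c : t0 < c -> c <= b -> {for c, continuous f}.
  by move=> c0 cb; exact: is_derive_continuous (dfc c c0 cb).
have dab x : x \in `]a, b[ -> is_derive x (1 : R) f (f' x).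
  rewrite in_itv /= => /andP[ax xb].
  by apply: dfc; [exact: le_lt_trans ax | exact: ltW].
have cab : {within `[a, b], continuous f}.
  apply/(continuous_within_itvP _ ab); split.
  - move=> x; rewrite in_itv /= => /andP[ax xb].
    by apply: cfc; [exact: le_lt_trans ax | exact: ltW].
  - move: a0; rewrite le_eqVlt => /orP[/eqP<- //|a0].
    by apply: cvg_at_right_filter; apply: cfc => //; exact: ltW.
  - by apply: cvg_at_left_filter; apply: cfc.
have [c] := MVT ab dab cab.
by rewrite in_itv /= => acb e; exists c.
Qed.

Lemma evolves_const f (t : R) : evolves R t0 T f (fun=> 0) -> t0 <= t ->
  (t%:E < T)%E -> f t = f t0.
Proof.
move=> ef; rewrite le_eqVlt => /orP[/eqP<- //|tt0] tT.
have [c _] := evolves_MVT _ _ _ _ ef (lexx t0) tt0 tT.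
by rewrite mul0r => /eqP; rewrite subr_eq0 => /eqP.
Qed.

Lemma evolves_increment_le f f' (k a b : R) : evolves R t0 T f f' ->
  t0 <= a -> a <= b -> (b%:E < T)%E ->
  (forall c : R, a < c < b -> f' c <= k) -> f b - f a <= k * (b - a).
Proof.
move=> ef a0; rewrite le_eqVlt => /orP[/eqP<-|ab] bT le_k.
  by rewrite !subrr mulr0.
have [c cab ->] := evolves_MVT _ _ _ _ ef a0 ab bT.
by rewrite ler_wpM2r ?le_k// subr_ge0 ltW.
Qed.

Lemma evolves_increment_ge f f' (k a b : R) : evolves R t0 T f f' ->
  t0 <= a -> a <= b -> (b%:E < T)%E ->
  (forall c : R, a < c < b -> k <= f' c) -> k * (b - a) <= f b - f a.
Proof.
move=> ef a0; rewrite le_eqVlt => /orP[/eqP<-|ab] bT le_k.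
  by rewrite !subrr mulr0.
have [c cab ->] := evolves_MVT _ _ _ _ ef a0 ab bT.
by rewrite ler_wpM2r ?le_k// subr_ge0 ltW.
Qed.
End evolution.

(** * The invariants along a solution: conservation and finite lifetime *)

(** A lower bound for [x] in terms of its cube without extracting a cube
    root: for [0 <= x <= 1] the cube is at most [x]. *)
Lemma cube_ge (R : realType) (m x : R) :
  0 <= x -> m <= x ^+ 3 -> Num.min 1 m <= x.
Proof.
move=> x0 mx; rewrite ge_min; case: (leP 1 x) => //= x1.
apply: le_trans mx _; rewrite -[leRHS]expr1.
by apply: ler_wiXn2l => //; exact: ltW.
Qed.

Section invariants_system.
Variables (R : realType) (T : \bar R) (s d : R -> R).
Hypothesis es : evolves R 0 T s (fun t => - (6 * d t)).
Hypothesis ed : evolves R 0 T d (fun t => - (s t ^+ 2 / 6)).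
Hypothesis s_ge0 : forall t : R, 0 <= s t.

Lemma discriminant_conserved (t : R) : 0 <= t -> (t%:E < T)%E ->
  s t ^+ 3 - 54 * d t ^+ 2 = s 0 ^+ 3 - 54 * d 0 ^+ 2.
Proof.
apply: (evolves_const _ _ _ (fun t => s t ^+ 3 - 54 * d t ^+ 2)).
have [[s0 ds] [d0 dd]] := (es, ed).
split.
  apply: cvgB; first exact: (cvgM s0 (cvgM s0 s0)).
  apply: cvgM; first exact: cvg_cst.
  exact: (cvgM d0 d0).
move=> x x0 xT; have hs := ds _ x0 xT; have hd := dd _ x0 xT.
apply: is_derive_eq; rewrite /GRing.scale /=; by field.
Qed.

Lemma det_nonincreasing (a b : R) : 0 <= a -> a <= b -> (b%:E < T)%E ->
  d b <= d a.
Proof.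
move=> a0 ab bT; rewrite -subr_le0 -(mul0r (b - a)).
apply: (evolves_increment_le _ _ _ _ _ _ _ _ ed) => // c _.
by rewrite oppr_le0 divr_ge0// sqr_ge0.
Qed.

Hypothesis disc_ge0 : 0 <= s 0 ^+ 3 - 54 * d 0 ^+ 2.
Hypothesis not_double : 0 < s 0 ^+ 3 - 54 * d 0 ^+ 2 \/ d 0 < 0.

(** If the conserved quantity is positive it bounds [s^3] from below; if not,
    [54 d^2 <= s^3] does so, as [d] starts negative and decreases. *)
Lemma norm_bounded_below : exists2 c : R, 0 < c &
  forall t : R, 0 <= t -> (t%:E < T)%E -> c <= s t.
Proof.
have [C0|d0] := not_double.
- exists (Num.min 1 (s 0 ^+ 3 - 54 * d 0 ^+ 2)).
    by rewrite lt_min ltr01.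
  move=> t t0 tT; apply: cube_ge => //.
  rewrite -(discriminant_conserved _ t0 tT) gerBl.
  by rewrite mulr_ge0// sqr_ge0.
- exists (Num.min 1 (54 * d 0 ^+ 2)).
    by rewrite lt_min ltr01 mulr_gt0// exprn_even_gt0//= lt_eqF.
  move=> t t0 tT; apply: cube_ge => //.
  have dt := det_nonincreasing _ _ (lexx 0) t0 tT.
  have := discriminant_conserved _ t0 tT; move: disc_ge0; nra.
Qed.

(** For an infinite lifetime, [d] would become negative since
    [d' <= - c^2 / 6] for any positive lower bound [c] of [s], and then the
    negative function [s / d] would have slope at least [3] forever. *)
Lemma blowup_time_finite : T != +oo%E.
Proof.
apply/eqP => Too.
have ltT t : (t%:E < T)%E by rewrite Too ltry.
have [c c0 sc] := norm_bounded_below.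
have [t1 t10 dt1] : exists2 t : R, 0 < t & d t < 0.
  (* At slope - k, the value 0 is crossed before the time (|d 0| + 1) / k. *)
  pose k := c ^+ 2 / 6.
  have k0 : 0 < k by rewrite divr_gt0// exprn_gt0.
  pose t := (`|d 0| + 1) / k.
  have t0 : 0 < t by rewrite divr_gt0 ?ltr_pwDr.
  exists t => //.
  have : d t - d 0 <= - k * (t - 0).
    apply: (evolves_increment_le _ _ _ _ _ _ _ _ ed) => // [|x /andP[x0 _]].
      exact: ltW.
    rewrite lerN2 ler_pM2r ?invr_gt0//.
    by apply: lerXn2r; rewrite ?nnegrE ?(ltW c0)// sc// ltW.
  rewrite subr0 mulNr mulrC divfK ?gt_eqF//.
  by have := ler_norm (d 0); lra.
have dneg (t : R) : t1 <= t -> d t < 0.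
  by move=> t1t; apply: le_lt_trans dt1;
    apply: det_nonincreasing => //; exact: ltW.
have spos (t : R) : t1 <= t -> 0 < s t.
  move=> t1t; apply: lt_le_trans c0 _; apply: sc => //.
  by apply: le_trans t1t; exact: ltW.
pose z t := s t / d t.
have z_lt0 (t : R) : t1 <= t -> z t < 0.
  by move=> t1t; rewrite /z pmulr_rlt0 ?invr_lt0 ?dneg ?spos.
have dz (t : R) : t1 <= t ->
    is_derive t (1 : R) z (-6 + s t ^+ 3 / (6 * d t ^+ 2)).
  move=> t1t; have t0 := lt_le_trans t10 t1t.
  have hs := es.2 _ t0 (ltT t); have hd := ed.2 _ t0 (ltT t).
  have dn0 : d t != 0 by rewrite lt_eqF// dneg.
  have hV := is_deriveV dn0 hd.
  apply: is_derive_eq; rewrite /GRing.scale /=; by field.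
have ez : evolves R t1 T z (fun t => -6 + s t ^+ 3 / (6 * d t ^+ 2)).
  split; last by move=> t /ltW t1t _; exact: dz.
  by apply: cvg_at_right_filter; exact: is_derive_continuous (dz _ (lexx t1)).
(* A function of slope at least 3 starting from z t1 is nonnegative at t2. *)
pose t2 := t1 - z t1 / 3.
have t12 : t1 <= t2.
  by rewrite lerDl oppr_ge0 pmulr_lle0 ?invr_gt0// ltW// z_lt0.
have : 3 * (t2 - t1) <= z t2 - z t1.
  apply: (evolves_increment_ge _ _ _ _ _ _ _ _ ez) => // t /andP[/ltW t1t _].
  have dn0 : 0 < d t ^+ 2 by rewrite exprn_even_gt0//= lt_eqF// dneg.
  have t0 := le_trans (ltW t10) t1t.
  have d6 : 0 < 6 * d t ^+ 2 by rewrite pmulr_rgt0.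
  rewrite -lerBlDl opprK ler_pdivlMr//.
  by have := discriminant_conserved _ t0 (ltT t); move: disc_ge0; lra.
have -> : t2 - t1 = - (z t1 / 3) by rewrite /t2 addrC addKr.
by have := z_lt0 _ t12; move: (z t1) (z t2) => x y; lra.
Qed.

End invariants_system.

Section solutions.
Variables (R : realType) (M : R -> 'M[R]_3) (T : \bar R).
Hypothesis sol : ode_solution M T.

(** Continuity at [0] is implied by the one-sided derivative there:
    [M h = M 0 + h * q h] with a convergent quotient [q]. *)
Lemma solution_right_continuous i j : M t i j @[t --> 0^'+] --> M 0 i j.
Proof.
have [T0 sM M0 dM] := sol.
have q : (h^-1 *: (M h - M 0)) i j @[h --> 0^'+] --> ode_rhs (M 0) i j.
  apply: (cvg_comp (fun h => h^-1 *: (M h - M 0))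
    (fun B : 'M[R]_3 => B i j) M0).
  exact: coord_continuous.
have h0 : h @[h --> (0 : R)^'+] --> (0 : R).
  by apply: cvg_at_right_filter; exact: cvg_id.
have c : M 0 i j + h * (h^-1 *: (M h - M 0)) i j @[h --> 0^'+] --> M 0 i j.
  rewrite [X in _ --> X](_ : _ = M 0 i j + 0 * ode_rhs (M 0) i j);
    last by rewrite mul0r addr0.
  by apply: cvgD; [exact: cvg_cst | exact: (cvgM h0 q)].
apply: cvg_trans c; apply: near_eq_cvg; near=> h.
have hn0 : h != 0 by near: h; exact: nbhs_right_neq.
by rewrite /= !mxE mulVKf//; ring.
Unshelve. all: by end_near. Qed.

Lemma evolves_frobenius :
  evolves R 0 T (fun t => frobenius_sq (M t)) (fun t => - (6 * \det (M t))).
Proof.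
have [T0 sM _ dM] := sol; split.
  have c := solution_right_continuous.
  rewrite frobenius_sqE; under eq_fun do rewrite frobenius_sqE.
  have c2 i j := cvgM (c i j) (c i j).
  by do ?[exact: c2 | apply: cvgD].
move=> t t0 tT; apply: is_derive_frobenius; last exact: dM.
by apply: sM => //; exact: ltW.
Qed.

Lemma evolves_det :
  evolves R 0 T (fun t => \det (M t))
    (fun t => - (frobenius_sq (M t) ^+ 2 / 6)).
Proof.
have [T0 sM _ dM] := sol; split.
  have c := solution_right_continuous.
  rewrite det3; under eq_fun do rewrite det3.
  by do ?[exact: c | apply: cvgM | apply: cvgB | apply: cvgD].
move=> t t0 tT; apply: is_derive_det; last exact: dM.
by apply: sM => //; exact: ltW.
Qed.
End solutions.

(** * Scalar autonomous equations by quadrature *)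

Lemma primitive_exists (R : realType) (f : R -> R) (a b : R) :
  {in `[a, b], continuous f} ->
  exists F : R -> R, forall x, x \in `]a, b[ -> is_derive x (1 : R) F (f x).
Proof.
move=> cf.
exists (fun x => \int[lebesgue_measure]_(t in [set` `[a, x]]) f t) => x xab.
have /andP[ax xb] : a < x < b by move: xab; rewrite in_itv.
have fi : lebesgue_measure.-integrable `[a, b] (EFin \o f).
  apply: continuous_compact_integrable; first exact: segment_compact.
  by apply: continuous_in_subspaceT => y /set_mem; exact: cf.
have [dF F'] := continuous_FTC1_closed xb fi ax
  (cf _ (subset_itv_oo_cc xab)).
by apply: DeriveDef; [exact: dF | rewrite -derive1E; exact: F'].
Qed.

(** Separation of variables: if [F] is a primitive of [1 / g], then [F] is
    strictly increasing and its inverse [G] satisfies [G' = g (G)]. *)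
Lemma autonomous_ode_local_solution (R : realType) (g : R -> R) (r : R) :
  0 < r -> (forall x : R, `|x| <= r -> {for x, continuous g}) ->
  (forall x : R, `|x| <= r -> 0 < g x) ->
  exists (e : R) (w : R -> R), [/\ 0 < e, w 0 = 0 &
    forall t : R, `|t| < e -> `|w t| < r /\ is_derive t (1 : R) w (g (w t))].
Proof.
move=> r0 cg g0.
have normr_itv x : x \in `[- r, r] -> `|x| <= r by rewrite in_itv /= ler_norml.
have normr_oo x : `|x| < r -> x \in `](- r), r[ by rewrite in_itv /= ltr_norml.
have [F dF] : exists F : R -> R,
    forall x : R, `|x| < r -> is_derive x (1 : R) F (g x)^-1.
  have [|F dF] := primitive_exists R (fun x => (g x)^-1) (- r) r.
    move=> x /normr_itv xr.
    by apply: cvgV; [rewrite gt_eqF// g0 | exact: cg].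
  by exists F => x /normr_oo; exact: dF.
have cF (x : R) : `|x| < r -> {for x, continuous F}.
  by move=> xr; exact: is_derive_continuous _ _ _ _ (dF x xr).
have Fmono (x y : R) : `|x| < r -> `|y| < r -> x < y -> F x < F y.
  move=> xr yr xy.
  have sub z : z \in `[x, y] -> `|z| < r.
    move: xr yr; rewrite in_itv /= !ltr_norml =>
      /andP[? ?] /andP[? ?] /andP[? ?].
    by apply/andP; split; lra.
  have [||z zxy] := @MVT R F (fun x => (g x)^-1) x y xy.
  - by move=> z zxy; apply: dF; apply: sub; exact: subset_itv_oo_cc.
  - by apply: continuous_in_subspaceT => z /set_mem zxy; apply: cF; exact: sub.
  rewrite -subr_gt0 => ->; rewrite mulr_gt0 ?subr_gt0// invr_gt0 g0// ltW//
    sub//.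
  exact: subset_itv_oo_cc.
have Finj (x y : R) : `|x| < r -> `|y| < r -> F x = F y -> x = y.
  move=> xr yr e; case: (ltgtP x y) => // h.
  - by have := Fmono _ _ xr yr h; rewrite e ltxx.
  - by have := Fmono _ _ yr xr h; rewrite e ltxx.
(* F is known to be injective only on the interval, so its inverse is chosen
   there. *)
pose G z := xget 0 [set x : R | `|x| < r /\ F x = z].
have GF (x : R) : `|x| < r -> G (F x) = x.
  move=> xr; rewrite /G; case: xgetP => [y _ [yr /Finj]|/(_ x)]; first exact.
  by case.
have r2 : `|r / 2| < r by rewrite gtr0_norm; lra.
have r2' : `|- (r / 2)| < r by rewrite normrN.
have r00 : `|0 : R| < r by rewrite normr0.
have Fhi : F 0 < F (r / 2) by apply: Fmono => //; lra.
have Flo : F (- (r / 2)) < F 0 by apply: Fmono => //; lra.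
exists (Num.min (F (r / 2) - F 0) (F 0 - F (- (r / 2)))).
exists (fun t => G (F 0 + t)); split.
- by rewrite lt_min !subr_gt0 Fhi Flo.
- by rewrite addr0 GF.
move=> t; rewrite lt_min => /andP[th tl].
have [x xr Fx] : exists2 x : R, `|x| < r & F x = F 0 + t.
  have [|||x] := @IVT R F (- (r / 2)) (r / 2) (F 0 + t).
  - by lra.
  - apply: continuous_in_subspaceT => z /set_mem /=.
    rewrite in_itv /= => /andP[z1 z2]; apply: cF; rewrite ltr_norml; lra.
  - rewrite min_l ?max_r ?(ltW (lt_trans Flo Fhi))//.
    by move: th tl; rewrite !ltr_norml => /andP[? ?] /andP[? ?]; lra.
  rewrite in_itv /= => /andP[z1 z2] e; exists x => //; rewrite ltr_norml; lra.
rewrite -Fx GF//; split => //.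
have nr : \forall y \near x, `|y| < r :=
  cvgr_lt _ (@norm_continuous R R^o x) _ xr.
have dG : is_derive (F 0 + t) (1 : R) G (g x).
  rewrite -Fx -[g x]invrK; apply: (@is_derive_inverse R F).
  - by near=> y; apply: GF; near: y; exact: nr.
  - by near=> y; apply: cF; near: y; exact: nr.
  - exact: dF.
  - by rewrite invr_eq0 gt_eqF// g0// ltW.
have dS : is_derive t (1 : R) (fun t => F 0 + t) 1
  by under eq_fun do rewrite addrC; exact: is_derive_shift.
have := @is_derive1_comp R G (fun t => F 0 + t) t _ _ dG dS.
by rewrite mulr1.
Unshelve. all: by end_near. Qed.

(** * Local existence for the matrix equation *)

Lemma sym_tracefree_rhs (R : realType) (A : 'M[R]_3) :
  sym_tracefree A -> sym_tracefree (ode_rhs A).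
Proof.
move=> sA; have [sym _] := sA; split.
  by rewrite /ode_rhs linearB /= tr_scalar_mx trmx_mul sym.
rewrite /mxtrace sum3 !ode_rhsE frobenius_sqE /=.
have [-> -> -> ->] := sym_tracefreeE _ _ sA.
by field.
Qed.

Lemma sym_tracefreeD (R : realType) (A B : 'M[R]_3) (k : R) :
  sym_tracefree A -> sym_tracefree B -> sym_tracefree (A + k *: B).
Proof.
move=> [sA tA] [sB tB]; split; first by rewrite linearD linearZ /= sA sB.
by rewrite mxtraceD mxtraceZ tA tB mulr0 addr0.
Qed.

Lemma ode_rhsZ (R : realType) (A : 'M[R]_3) (k : R) :
  ode_rhs (k *: A) = k ^+ 2 *: ode_rhs A.
Proof.
apply/matrixP => i j; rewrite [RHS]mxE !ode_rhsE !frobenius_sqE !mxE.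
case: (i == j); rewrite ?mulr1n ?mulr0n; ring.
Qed.

(** The reciprocal cube of the coefficient [a] in the solution
    [a (A + v ode_rhs A)], as a function of [v]; here [s] and [d] are the
    squared norm and the determinant of [A]. *)
Definition pencil_cubic (R : realType) (s d v : R) : R :=
  1 - s / 2 * v ^+ 2 + d * v ^+ 3.

(** The plane spanned by [A] and [ode_rhs A] is invariant under [ode_rhs], a
    consequence of [A^3 = (s / 2) A + d].  The decomposition along
    [A + v ode_rhs A] and [ode_rhs A] is the one that separates the equations
    for [a] and [v]: the first coefficient drives [a], the second drives [v]. *)
Lemma ode_rhs_pencil (R : realType) (A : 'M[R]_3) (v : R) :
  sym_tracefree A ->
  let s := frobenius_sq A in let d := \det A in
  ode_rhs (A + v *: ode_rhs A) =
    (s / 3 * v - d * v ^+ 2) *: (A + v *: ode_rhs A)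
    + pencil_cubic R s d v *: ode_rhs A.
Proof.
move=> sA /=; have [e10 e20 e21 e22] := sym_tracefreeE _ _ sA.
have := ode_rhsE _ A; move: (ode_rhs A) => C CE.
apply/matrixP; rewrite /pencil_cubic => i j.
rewrite [LHS]ode_rhsE [RHS]mxE !frobenius_sqE det3 !mxE !CE !frobenius_sqE.
rewrite e10 e20 e21 e22.
by move: i j; apply: ord3P; apply: ord3P;
  rewrite /= ?mulr0n ?mulr1n ?e10 ?e20 ?e21 ?e22; field.
Qed.

Section inverse_cube_root.
Variables (R : realType) (s d : R).
Let q := pencil_cubic R s d.

Definition inv_cbrt (v : R) : R := expR (- (ln (q v) / 3)).

Lemma inv_cbrt_gt0 v : 0 < inv_cbrt v. Proof. exact: expR_gt0. Qed.

Lemma inv_cbrtK v : 0 < q v -> inv_cbrt v ^+ 3 * q v = 1.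
Proof.
move=> q0; rewrite /inv_cbrt -expRM_natl.
have -> : 3%:R * - (ln (q v) / 3) = - ln (q v) by field.
by rewrite expRN lnK ?posrE// mulVf// gt_eqF.
Qed.

Lemma is_derive_pencil_cubic v :
  is_derive v (1 : R) q (- (s * v) + 3 * d * v ^+ 2).
Proof.
rewrite /q /pencil_cubic; apply: is_derive_eq; rewrite /GRing.scale /=.
by field.
Qed.

(** With [a^-3 = q] one has [a' = - a^4 q' / 3]. *)
Lemma is_derive_inv_cbrt v : 0 < q v ->
  is_derive v (1 : R) inv_cbrt
    (inv_cbrt v ^+ 4 * (s / 3 * v - d * v ^+ 2)).
Proof.
move=> q0; have dq := is_derive_pencil_cubic v.
have dln := @is_derive1_comp R (@ln R) q v _ _ (is_derive1_ln q0) dq.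
have din : is_derive v (1 : R) (fun x => - (ln (q x) / 3))
    (- (((q v)^-1 * (- (s * v) + 3 * d * v ^+ 2)) / 3)).
  apply: is_derive_eq; rewrite /GRing.scale /=; ring.
have := @is_derive1_comp R (@expR R) (fun x => - (ln (q x) / 3)) v _ _
  (is_derive_expR _) din.
rewrite -/(inv_cbrt v) => h; apply: (is_derive_eq h).
have -> : (q v)^-1 = inv_cbrt v ^+ 3.
  by rewrite -[LHS]mul1r -(inv_cbrtK v q0) mulfK// gt_eqF.
by field.
Qed.
End inverse_cube_root.

(** For [N = a (A + v X)] with [X = ode_rhs A], the equation asks that
    [a' = a^2 (s v / 3 - d v^2)] and [a v' = a^2 q], where [q] is the cubic in
    [v].  Taking [a^3 q = 1] turns the second equation into [v' = a^-2], and the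
    first then follows by the chain rule. *)
Theorem local_existence (R : realType) (A : 'M[R]_3) : sym_tracefree A ->
  exists (e : R) (N : R -> 'M[R]_3), [/\ 0 < e, N 0 = A &
    forall t : R, `|t| < e ->
      sym_tracefree (N t) /\ is_derive t (1 : R) N (ode_rhs (N t))].
Proof.
move=> sA; pose s := frobenius_sq A; pose d := \det A.
pose q := pencil_cubic R s d; pose a := inv_cbrt R s d.
have q0 : q 0 = 1 by rewrite /q /pencil_cubic; ring.
have [r r0 qr] : exists2 r : R, 0 < r & forall x : R, `|x| <= r -> 0 < q x.
  have cq : q x @[x --> (0 : R)] --> (1 : R).
    by rewrite -q0; exact: is_derive_continuous _ _ _ _
      (is_derive_pencil_cubic R s d 0).
  have /nbhs_normP [r /= r0 rq] :=
    cvgr_gt (FF := nbhs_filter (0 : R)) _ cq _ (@ltr01 R).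
  exists (r / 2); first by rewrite divr_gt0.
  by move=> x xr; apply: rq; rewrite /= sub0r normrN; lra.
have an0 v : a v != 0 by rewrite gt_eqF// inv_cbrt_gt0.
have [e [v [e0 v0 dv]]] : exists (e : R) (v : R -> R), [/\ 0 < e, v 0 = 0 &
    forall t : R, `|t| < e ->
      `|v t| < r /\ is_derive t (1 : R) v ((a (v t)) ^- 2)].
  apply: (autonomous_ode_local_solution R (fun v => (a v) ^- 2)) => // x xr.
    have ca := is_derive_continuous _ _ _ _
      (is_derive_inv_cbrt R s d x (qr x xr)).
    apply: cvgV; first by rewrite expf_neq0.
    exact: (cvgM ca ca).
  by rewrite invr_gt0 exprn_gt0// inv_cbrt_gt0.
exists e, (fun t => a (v t) *: (A + v t *: ode_rhs A)); split=> //.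
  rewrite v0 scale0r addr0 (_ : a 0 = 1) ?scale1r//.
  by rewrite /a /inv_cbrt -/q -/(q 0) q0 ln1 mul0r oppr0 expR0.
move=> t te; have [vr dvt] := dv t te.
have qv := qr _ (ltW vr).
have sX : sym_tracefree (A + v t *: ode_rhs A).
  exact: sym_tracefreeD _ _ _ _ sA (sym_tracefree_rhs _ _ sA).
split.
  rewrite -[_ *: _]add0r; apply: sym_tracefreeD => //.
  by split; [rewrite trmx0 | rewrite mxtrace0].
apply: is_derive_matrix => i j.
have da := @is_derive1_comp R a v t _ _ (is_derive_inv_cbrt R s d _ qv) dvt.
have -> : (fun x => (a (v x) *: (A + v x *: ode_rhs A)) i j) =
    (fun x => a (v x) * (A i j + v x * ode_rhs A i j)).
  by apply/funext => x; rewrite !mxE.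
rewrite ode_rhsZ ode_rhs_pencil//.
move: (ode_rhs A) => C.
have K := inv_cbrtK R s d _ qv.
rewrite /comp in da.
apply: is_derive_eq.
rewrite /GRing.scale /= !mxE -/s -/d -/a -/q.
move: (an0 (v t)) K; rewrite -/a -/q; move: (a (v t)) (q (v t)) => y z yn0 K.
have -> : z = y^-1 ^+ 3.
  by apply: (mulfI (expf_neq0 3 yn0)); rewrite K -exprMn divff// expr1n.
by field.
Qed.

(** * Continuation of bounded solutions *)

Lemma at_left_interval (R : realType) (T : R) (P : R -> Prop) :
  (\forall t \near T^'-, P t) ->
  exists2 e : R, 0 < e & forall t : R, T - e < t -> t < T -> P t.
Proof.
case=> e /= e0 eP; exists e => // t te tT; apply: eP => //=.
by rewrite ger0_norm; lra.
Qed.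

Lemma is_derive_right_quotient (R : realType) (f : R -> R) (x l : R) :
  is_derive x (1 : R) f l -> h^-1 * (f (h + x) - f x) @[h --> 0^'+] --> l.
Proof.
case=> df <-; apply: cvg_dnbhs_at_right.
have -> : (fun h : R => h^-1 * (f (h + x) - f x)) =
    (fun h => h^-1 *: (f (h *: 1 + x) - f x)).
  by apply/funext => h; rewrite /GRing.scale /= mulr1.
exact: df.
Qed.

(** To the left of [T] the difference quotient is a value of [f'] by the mean
    value theorem, so the limit of [f'] is also the left derivative. *)
Lemma is_derive_glue (R : realType) (f f' : R -> R) (T e l : R) :
  0 < e -> (forall t : R, T - e < t -> t < T -> is_derive t (1 : R) f (f' t)) ->
  f t @[t --> T^'-] --> f T -> f' t @[t --> T^'-] --> l ->
  h^-1 * (f (h + T) - f T) @[h --> 0^'+] --> l ->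
  is_derive T (1 : R) f l.
Proof.
move=> e0 df fT f'T rq.
suff q : h^-1 *: (f (h *: 1 + T) - f T) @[h --> 0^'] --> l.
  by apply: DeriveDef; [exact: cvgP q | exact: cvg_lim q].
have -> : (fun h : R => h^-1 *: (f (h *: 1 + T) - f T)) =
    (fun h => h^-1 * (f (h + T) - f T)).
  by apply/funext => h; rewrite /GRing.scale /= mulr1.
apply: (@cvg_at_right_left_dnbhs R R^o) => //.
apply/cvgrPdist_le => eps eps0.
have [a a0 aP] := at_left_interval _ _ _ (cvgr_dist_le _ _ f'T _ eps0).
near=> h.
have h0 : h < 0 by near: h; exact: nbhs_left_lt.
have hm : - Num.min e a < h.
  by near: h; apply: nbhs_left_gt; rewrite oppr_lt0 lt_min e0.
have [he ha] : - e < h /\ - a < h.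
  by move: hm; rewrite ltrNl lt_min ltrNl => /andP[? ?];
    split => //; rewrite ltrNl.
have hT : h + T < T by lra.
have dft t : h + T <= t -> t < T -> is_derive t (1 : R) f (f' t).
  by move=> ht tT; apply: df => //; lra.
have [||c] := @MVT R f f' _ _ hT.
- by move=> t; rewrite in_itv /= => /andP[/ltW ht tT]; exact: dft.
- apply/(continuous_within_itvP _ hT); split => //.
  + move=> t; rewrite in_itv /= => /andP[/ltW ht tT].
    exact: is_derive_continuous (dft t ht tT).
  + apply: cvg_at_right_filter.
    exact: is_derive_continuous (dft _ (lexx _) hT).
rewrite in_itv /= => /andP[hc cT] fc.
have -> : h^-1 * (f (h + T) - f T) = f' c.
  have -> : f (h + T) - f T = h * f' c by rewrite -opprB fc; ring.
  by rewrite mulKf// lt_eqF.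
by apply: aP => //; lra.
Unshelve. all: by end_near. Qed.

(** If [|f'| <= K], then [f t + K t] is nondecreasing and bounded above near
    [T], hence converges. *)
Lemma bounded_derivative_left_limit (R : realType) (f f' : R -> R) (T K : R) :
  0 < T -> (forall t : R, 0 < t -> t < T -> is_derive t (1 : R) f (f' t)) ->
  (forall t : R, 0 < t -> t < T -> `|f' t| <= K) ->
  cvg (f t @[t --> T^'-]).
Proof.
move=> T0 df f'K.
have lip a b : 0 < a -> a <= b -> b < T -> `|f b - f a| <= K * (b - a).
  move=> a0; rewrite le_eqVlt => /orP[/eqP<-|ab] bT;
    first by rewrite !subrr normr0 mulr0.
  have dft t : a <= t -> t <= b -> is_derive t (1 : R) f (f' t).
    move=> ta tb; apply: df; lra.
  have [||c] := @MVT R f f' _ _ ab.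
  - by move=> t; rewrite in_itv /= => /andP[/ltW ? /ltW ?]; exact: dft.
  - apply: continuous_in_subspaceT => t /set_mem /=;
      rewrite in_itv /= => /andP[? ?].
    by apply: is_derive_continuous; exact: dft.
  rewrite in_itv /= => /andP[ac cb] ->;
    rewrite normrM (gtr0_norm (x := b - a)) ?subr_gt0//.
  by rewrite ler_wpM2r ?subr_ge0 ?(ltW ab)// f'K//; lra.
pose g t := f t + K * t.
have gcv : cvg (g t @[t --> T^'-]).
  apply: nondecreasing_at_left_is_cvgr.
  - near=> x => a b; rewrite !in_itv /= => /andP[xa aT] /andP[xb bT] ab.
    have x0 : 0 < x by near: x; exact: nbhs_left_gt.
    have := lip a b (lt_trans x0 xa) ab bT.
    by rewrite /g ler_norml => /andP[]; lra.
  - near=> x.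
    have x0 : 0 < x by near: x; exact: nbhs_left_gt.
    have xT : x < T by near: x; exact: nbhs_left_lt.
    exists (f x + K * (T - x) + K * T) => _ [y + <-].
    rewrite /= in_itv /= => /andP[xy yT].
    have := lip x y x0 (ltW xy) yT; rewrite ler_norml => /andP[_].
    have K0 : 0 <= K by apply: le_trans (f'K x x0 xT); exact: normr_ge0.
    have : K * y <= K * T by rewrite ler_wpM2l// ltW.
    have : K * (y - x) <= K * (T - x) by rewrite ler_wpM2l// lerD2r ltW.
    by rewrite /g; lra.
have -> : f = (fun t => g t - K * t) by apply/funext => t; rewrite /g; lra.
apply: is_cvgB => //; apply: cvgP.
apply: cvg_at_left_filter; apply: cvgM; [exact: cvg_cst | exact: cvg_id].
Unshelve. all: by end_near. Qed.

Lemma ode_rhs_bounded (R : realType) (A : 'M[R]_3) (K : R) i j :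
  frobenius_sq A <= K -> `|ode_rhs A i j| <= 4 * K.
Proof.
move=> AK; have AijK k l : A k l ^+ 2 <= K.
  by apply: le_trans AK; exact: sqr_entry_le_frobenius.
have prod (x y : R) : x ^+ 2 <= K -> y ^+ 2 <= K -> - K <= x * y <= K.
  move=> xK yK; have := sqr_ge0 (x + y); have := sqr_ge0 (x - y).
  by rewrite sqrrB sqrrD; lra.
have F0 : 0 <= frobenius_sq A
  by apply: le_trans (sqr_entry_le_frobenius _ A i j); exact: sqr_ge0.
rewrite ode_rhsE ler_norml.
have /andP[? ?] := prod _ _ (AijK i i0) (AijK i0 j).
have /andP[? ?] := prod _ _ (AijK i i1) (AijK i1 j).
have /andP[? ?] := prod _ _ (AijK i i2) (AijK i2 j).
by case: (i == j); rewrite ?mulr1n ?mulr0n; lra.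
Qed.

Lemma cvg_ode_rhs (R : realType) (T : Type) (F : set_system T) (FF : Filter F)
    (M : T -> 'M[R]_3) (A : 'M[R]_3) :
  (forall i j, M t i j @[t --> F] --> A i j) ->
  forall i j, ode_rhs (M t) i j @[t --> F] --> ode_rhs A i j.
Proof.
move=> MA i j; rewrite ode_rhsE.
under eq_fun do rewrite ode_rhsE.
have sq k l : M t k l ^+ 2 @[t --> F] --> A k l ^+ 2
  by exact: (cvgM (MA k l) (MA k l)).
have fr : frobenius_sq (M t) @[t --> F] --> frobenius_sq A.
  rewrite frobenius_sqE; under eq_fun do rewrite frobenius_sqE.
  by do ?[exact: sq | apply: cvgD].
apply: cvgB; last by do ?[apply: cvgD]; apply: cvgM; exact: MA.
by apply: cvgMn; apply: cvgM; [exact: cvg_cst | exact: fr].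
Qed.

Lemma cvg_sym_tracefree (R : realType) (T : Type) (F : set_system T)
    (FF : ProperFilter F) (M : T -> 'M[R]_3) (A : 'M[R]_3) :
  (forall i j, M t i j @[t --> F] --> A i j) ->
  (\forall t \near F, sym_tracefree (M t)) -> sym_tracefree A.
Proof.
move=> MA sM; split.
  apply/matrixP => i j; rewrite mxE.
  apply: (cvg_unique (@Rhausdorff R) (MA j i)); apply: cvg_trans (MA i j).
  apply: near_eq_cvg; near=> t.
  have [sMt _] : sym_tracefree (M t) by near: t; exact: sM.
  by rewrite -[in LHS]sMt mxE.
rewrite /mxtrace sum3.
have c : M t i0 i0 + M t i1 i1 + M t i2 i2 @[t --> F] -->
  A i0 i0 + A i1 i1 + A i2 i2 by do ?[exact: MA | apply: cvgD].
apply: (cvg_unique (@Rhausdorff R) c); apply: cvg_near_cst; near=> t.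
have [_ ] : sym_tracefree (M t) by near: t; exact: sM.
by rewrite /mxtrace sum3.
Unshelve. all: by end_near. Qed.

(** The entries have bounded derivatives, so [M] has a limit [A] at [T]; the
    solution through [A] is attached there, and the two sides match to first
    order because [ode_rhs] is continuous. *)
Theorem bounded_solution_extends (R : realType) (M : R -> 'M[R]_3) (T K : R) :
  ode_solution M T%:E ->
  (forall t : R, 0 < t -> t < T -> frobenius_sq (M t) <= K) ->
  exists (e : R) (N : R -> 'M[R]_3), [/\ 0 < e, ode_solution N (T + e)%:E
    & forall t : R, t < T -> N t = M t].
Proof.
move=> [T0 sM M0 dM] MK; rewrite lte_fin in T0.
have dMe (t : R) : 0 < t -> t < T -> is_derive t (1 : R) M (ode_rhs (M t)).
  by move=> t0 tT; apply: dM => //; rewrite lte_fin.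
have cvM i j : cvg (M t i j @[t --> T^'-]).
  apply: (bounded_derivative_left_limit R (fun t => M t i j)
    (fun t => ode_rhs (M t) i j) T (4 * K)) => //.
    by move=> t t0 tT; apply: is_derive_entry; exact: dMe.
  by move=> t t0 tT; apply: ode_rhs_bounded; exact: MK.
pose A : 'M[R]_3 := \matrix_(i, j) lim (M t i j @[t --> T^'-]).
have MA i j : M t i j @[t --> T^'-] --> A i j by rewrite mxE; exact: cvM.
have sA : sym_tracefree A.
  apply: (cvg_sym_tracefree _ _ _ _ _ _ MA); near=> t; apply: sM.
  - by apply: ltW; near: t; exact: nbhs_left_gt.
  - by rewrite lte_fin; near: t; exact: nbhs_left_lt.
have [e [N [e0 N0 dN]]] := local_existence R A sA.
pose P t := if t < T then M t else N (t - T).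
have PM t : t < T -> P t = M t by rewrite /P => ->.
have PN t : T <= t -> P t = N (t - T) by rewrite /P leNgt => /negbTE ->.
exists e, P; split => //; split.
- by rewrite lte_fin addr_gt0.
- move=> t t0; rewrite lte_fin => tTe; case: (ltP t T) => tT.
    by rewrite PM//; apply: sM => //; rewrite lte_fin.
  rewrite PN//; apply: (dN _ _).1.
  by rewrite ger0_norm ?subr_ge0//; lra.
- rewrite PM//; apply: cvg_trans M0; apply: near_eq_cvg; near=> h.
  by rewrite !PM//; near: h; exact: nbhs_right_lt.
move=> t t0; rewrite lte_fin => tTe.
case: (ltgtP t T) => tT.
- rewrite PM//; apply: near_eq_is_derive (dMe t t0 tT).
  by near=> x; rewrite PM//; near: x; exact: lt_nbhsl.
- rewrite PN ?(ltW tT)//.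
  have [_ dNt] := dN (t - T) ltac:(rewrite ger0_norm; lra).
  apply: is_derive_matrix => i j.
  have dS : is_derive t (1 : R) (fun t => t - T) 1 by exact: is_derive_shift.
  have := @is_derive1_comp R (fun x => N x i j) (fun t => t - T) t _ _
    (is_derive_entry _ _ _ _ i j dNt) dS.
  rewrite mulr1; apply: near_eq_is_derive.
  by near=> x; rewrite /= PN//; apply: ltW; near: x; exact: lt_nbhsr.
rewrite tT; have PT : P T = A by rewrite PN// subrr N0.
rewrite PT; apply: is_derive_matrix => i j.
apply: (is_derive_glue R _ (fun t => ode_rhs (M t) i j) T T) => //.
- move=> x x0 xT.
  apply: near_eq_is_derive (is_derive_entry _ _ _ _ i j (dMe x _ xT)).
    by near=> y; rewrite PM//; near: y; exact: lt_nbhsl.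
  by move: x0; rewrite subrr.
- rewrite PT; apply: cvg_trans (MA i j); apply: near_eq_cvg; near=> x.
  by rewrite PM//; near: x; exact: nbhs_left_lt.
- exact: cvg_ode_rhs.
have [_ dN0] := dN 0 ltac:(by rewrite normr0).
have := is_derive_right_quotient _ _ _ _ (is_derive_entry _ _ _ _ i j dN0).
rewrite N0; apply: cvg_trans; apply: near_eq_cvg; near=> h.
rewrite PT addr0 PN ?addrK// lerDr; near: h; exact: nbhs_right_ge.
Unshelve. all: by end_near. Qed.

(** * Blow-up *)

(** As [d] is nonincreasing it suffices that it is not bounded below; otherwise
    [s^3 = C + 54 d^2] would be bounded and the solution could be extended. *)
Lemma maximal_det_unbounded (R : realType) (M : R -> 'M[R]_3) (T : R) :
  maximal_ode_solution M T%:E ->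
  forall K : R, \forall t \near T^'-, \det (M t) < K.
Proof.
move=> [sol maxM] K; have [T0 sM _ dM] := sol; rewrite lte_fin in T0.
have es := evolves_frobenius _ _ _ sol; have ed := evolves_det _ _ _ sol.
suff [t1 [t10 t1T dt1]] : exists t, [/\ 0 < t, t < T & \det (M t) < K].
  near=> t.
  apply: le_lt_trans dt1.
  apply: (det_nonincreasing _ _ _ _ ed); first exact: ltW.
    by near: t; exact: nbhs_left_ge.
  by rewrite lte_fin; near: t; exact: nbhs_left_lt.
apply: contrapT => noex.
have dK t : 0 < t -> t < T -> K <= \det (M t).
  by move=> t0 tT; rewrite leNgt; apply/negP => dt; apply: noex; exists t.
pose C := frobenius_sq (M 0) ^+ 3 - 54 * \det (M 0) ^+ 2.
(* The final 1 covers the times at which s <= 1, where s <= s^3 may fail. *)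
pose B := `|C| + 54 * (K ^+ 2 + \det (M 0) ^+ 2) + 1.
have [||e [N [e0 solN NM]]] := bounded_solution_extends R M T B => //.
  move=> t t0 tT.
  have tTE : (t%:E < T%:E)%E by rewrite lte_fin.
  have eC : frobenius_sq (M t) ^+ 3 - 54 * \det (M t) ^+ 2 = C :=
    discriminant_conserved _ _ _ _ es ed t (ltW t0) tTE.
  have d1 := dK t t0 tT.
  have d2 := det_nonincreasing _ _ _ _ ed _ _ (lexx 0) (ltW t0) tTE.
  have d3 : \det (M t) ^+ 2 <= K ^+ 2 + \det (M 0) ^+ 2.
    move: d1 d2; move: (\det (M t)) (\det (M 0)) => x y Kx xy.
    have := sqr_ge0 K; have := sqr_ge0 y.
    by case: (leP 0 x) => x0; [have : x ^+ 2 <= y ^+ 2 by nra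
      | have : x ^+ 2 <= K ^+ 2 by nra]; lra.
  have C1 := ler_norm C.
  have C0 := normr_ge0 C.
  have K20 := sqr_ge0 K; have D20 := sqr_ge0 (\det (M 0)).
  have s3 : frobenius_sq (M t) ^+ 3 <= `|C| + 54 * (K ^+ 2 + \det (M 0) ^+ 2).
    by move: eC d3 C1; clearbody C; lra.
  rewrite /B; case: (leP (frobenius_sq (M t)) 1) => s1; first lra.
  have : frobenius_sq (M t) <= frobenius_sq (M t) ^+ 3.
    by rewrite ler_eXnr// ltW.
  lra.
have : ((T + e)%:E <= T%:E)%E.
  by apply: maxM solN _ => t _; rewrite lte_fin; exact: NM.
by rewrite lee_fin; lra.
Unshelve. all: by end_near. Qed.

Theorem theorem6p1 (R : realType) (M : R -> 'M[R]_3) (Tmax : \bar R)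
    (lambda1 lambda2 lambda3 : R -> R)
    (hM : maximal_ode_solution M Tmax)
    (hlambda : forall t : R, 0 <= t -> (t%:E < Tmax)%E ->
      ordered_eigenvalues (M t) (lambda1 t) (lambda2 t) (lambda3 t))
    (hlambda3 : 0 < lambda3 0)
    (hr : 2^-1 < - (lambda1 0 / lambda3 0)) :
  exists T : R,
    [/\ 0 < T,
        Tmax = T%:E,
        lambda3 t @[t --> T^'-] --> +oo
      & - (lambda1 t / lambda3 t) @[t --> T^'-] --> (2 : R)].
Proof.
have [sol _] := hM; have [T0 sM _ _] := sol.
have es := evolves_frobenius _ _ _ sol; have ed := evolves_det _ _ _ sol.
have inv t : 0 <= t -> (t%:E < Tmax)%E ->
    [/\ lambda1 t + lambda2 t + lambda3 t = 0,
        lambda1 t <= lambda2 t, lambda2 t <= lambda3 t,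
        frobenius_sq (M t) = lambda1 t ^+ 2 + lambda2 t ^+ 2 + lambda3 t ^+ 2
      & \det (M t) = lambda1 t * lambda2 t * lambda3 t].
  move=> t0 tT; have ev := hlambda t t0 tT; have [l12 l23 _] := ev.
  by have [] := eigenvalues_invariants _ _ _ _ _ (sM t t0 tT) ev.
have [sum0 l12 l23 fr0 det0] := inv 0 (lexx 0) T0.
have lt12 : lambda1 0 < lambda2 0.
  by move: hr; rewrite -mulNr ltr_pdivlMr//; lra.
pose D := ((lambda1 0 - lambda2 0) * (lambda2 0 - lambda3 0)
  * (lambda1 0 - lambda3 0)) ^+ 2.
have disc0 : frobenius_sq (M 0) ^+ 3 - 54 * \det (M 0) ^+ 2 = 2 * D.
  by rewrite fr0 det0 discriminant_eigenvalues.
have Tfin : Tmax != +oo%E.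
  apply: (blowup_time_finite _ _ _ _ es ed) => [t||].
  - exact: frobenius_sq_ge0.
  - by rewrite disc0 mulr_ge0// sqr_ge0.
  - by rewrite disc0 det0; apply: simple_lowest_eigenvalue.
case: Tmax => [T||//] in hM hlambda sol T0 sM es ed inv Tfin *;
  last by rewrite eqxx in Tfin.
rewrite lte_fin in T0.
have dlim := maximal_det_unbounded _ _ _ hM.
have near_inv : \forall t \near T^'-, 0 <= t /\ (t%:E < T%:E)%E.
  near=> t; split; first by near: t; exact: nbhs_left_ge.
  by rewrite lte_fin; near: t; exact: nbhs_left_lt.
have l3lim : lambda3 t @[t --> T^'-] --> +oo.
  apply/cvgryPge => K; near=> t.
  have [t0 tT] : 0 <= t /\ (t%:E < T%:E)%E by near: t; exact: near_inv.
  have [s0 a b _ dt] := inv t t0 tT.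
  have k0 : 0 < `|K| + 1 by rewrite ltr_wpDl.
  apply: le_trans (top_eigenvalue_ge _ _ _ _ _ s0 a b k0 _).
    by apply: le_trans (ler_norm K) _; rewrite lerDl.
  by rewrite -dt; near: t; exact: dlim.
exists T; split => //.
apply/cvgrPdist_le => eps eps0; near=> t.
have [t0 tT] : 0 <= t /\ (t%:E < T%:E)%E by near: t; exact: near_inv.
have [s0 a b ft dt] := inv t t0 tT.
have l1 : 1 <= lambda3 t by near: t; move/cvgryPge : l3lim; apply.
have lD : (D + 1) / eps <= lambda3 t by near: t; move/cvgryPge : l3lim; apply.
have d0 : lambda1 t * lambda2 t * lambda3 t < 0.
  by rewrite -dt; near: t; exact: dlim.
rewrite opprK; apply: le_trans (ratio_defect_le _ _ _ _ s0 a b d0 l1) _.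
have -> : ((lambda1 t - lambda2 t) * (lambda2 t - lambda3 t)
    * (lambda1 t - lambda3 t)) ^+ 2 = D.
  have := discriminant_conserved _ _ _ _ es ed t t0 tT.
  rewrite disc0 ft dt discriminant_eigenvalues//.
  by apply: mulfI.
rewrite ler_pdivrMr; last by lra.
by rewrite mulrC -ler_pdivrMr.
Unshelve. all: by end_near. Qed.
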